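(* Let $p,q>0$ be real numbers. If $pq=4\cos^2\left(\frac{\pi}{m}\right)$ with $m\in\mathbb{Z}$ and $m\ge 3$, then the map $\mathfrak{m}:\mathbb{R}^2\to\mathbb{R}^2$ is periodic and its orbit has size $m+2$ when $m$ is odd and $\frac{m+2}{2}$ when $m$ is even.
   Context: Write $[x]_+=\max(x,0)$. For positive reals $p,q$, the maps $\mathfrak{m}_1,\mathfrak{m}_2:\mathbb{R}^2\to\mathbb{R}^2$ are $\mathfrak{m}_1(s,t)=(-s,\ t+p[s]_+)$ and $\mathfrak{m}_2(s,t)=(s+q[t]_+,\ -t)$, and the tropical map is $\mathfrak{m}=\mathfrak{m}_2\circ\mathfrak{m}_1$. The orbits are those of the discrete dynamical system on $\mathbb{R}^2$ obtained by iterating $\mathfrak{m}$. (The map $\mathfrak{m}$ and the integer $m$ are different objects.)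
   Formalization: The orbit size is claimed for every point of the plane except the origin, which is a fixed point of the map and so has an orbit of size 1; the map itself is also shown to have exactly this number as its least period. *)

(* Defs.v *)
From mathcomp Require Import all_boot all_order all_algebra.
From mathcomp Require Import all_classical all_reals all_analysis.
Set Implicit Arguments.
Unset Strict Implicit.
Unset Printing Implicit Defensive.
Import Order.TTheory GRing.Theory Num.Theory.
Local Open Scope classical_set_scope.
Local Open Scope ring_scope.

Definition pospart (R : realType) (x : R) : R := Num.max x 0.

Definition mut1 (R : realType) (p : R) (v : R * R) : R * R :=
  (- v.1, v.2 + p * pospart v.1).

Definition mut2 (R : realType) (q : R) (v : R * R) : R * R :=
  (v.1 + q * pospart v.2, - v.2).

Definition tropical_map (R : realType) (p q : R) : R * R -> R * R :=
  mut2 q \o mut1 p.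

Definition forward_orbit (T : Type) (f : T -> T) (x : T) : set T :=
  [set iter n f x | n in [set: nat]].

(* [n] is the least positive period of the map [f], as a map. *)
Definition periodic_of_order (T : Type) (f : T -> T) (n : nat) : Prop :=
  [/\ (0 < n)%N,
      forall x, iter n f x = x
    & forall k, (0 < k)%N -> (forall x, iter k f x = x) -> (n <= k)%N].

(* Main.v *)
Require Import Defs.
From mathcomp Require Import all_boot all_order all_algebra.
From mathcomp Require Import all_classical all_reals all_analysis.
From mathcomp Require Import ring lra zify.
Import Order.TTheory GRing.Theory Num.Theory.
Local Open Scope classical_set_scope.
Local Open Scope ring_scope.

(** Along an orbit of the tropical map the coordinates, rescaled by [sqrt p]
    and [sqrt q], are the terms of one sequence satisfying
    [b (n+1) + b (n-1) = 2 cos (pi / m) * max (b n) 0], so the tropical map is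
    conjugate to the square of the shift [(b (n-1), b n) |-> (b n, b (n+1))].
    While its terms are nonnegative the sequence is a sinusoid of
    half-period [m].  Hence an orbit of the shift that starts in the sector
    [b 0 <= 0 < b 1] stays nonnegative exactly up to [b m], is reflected twice,
    and comes back to its starting point after [m + 2] steps without meeting
    the sector in between.  Every nonzero orbit meets the sector, so each has
    exact period [m + 2] under the shift. *)

(** * Periods and orbits of an arbitrary self-map *)

Lemma iter_eq_dvdn {T : Type} {f : T -> T} {x : T} {d k : nat} : (0 < d)%N ->
  iter d f x = x -> (forall j, (0 < j < d)%N -> iter j f x <> x) ->
  iter k f x = x -> (d %| k)%N.
Proof.
move=> d_gt0 fd fj fk.
have iterMd n : iter (n * d) f x = x.
  by elim: n => // n IH; rewrite mulSn iterD IH.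
case: (posnP (k %% d)) => [/eqP//|r_gt0].
case: (fj (k %% d)%N); first by rewrite r_gt0 ltn_mod.
by rewrite -{2}fk {2}(divn_eq k d) addnC iterD iterMd.
Qed.

Lemma card_forward_orbit {T : Type} {f : T -> T} {x : T} {d : nat} :
  (0 < d)%N -> (forall k, iter k f x = x <-> (d %| k)%N) -> injective f ->
  (forward_orbit f x #= `I_d)%card.
Proof.
move=> d_gt0 fxE f_inj.
have iter_inj k : injective (iter k f).
  by elim: k => // k IH y z /= /f_inj /IH.
have -> : forward_orbit f x = (fun n => iter n f x) @` `I_d.
  apply/seteqP; split => [_ [n _ <-]|_ [n _ <-]]; last by exists n.
  exists (n %% d)%N; first by rewrite /= ltn_mod.
  rewrite {2}(divn_eq n d) addnC iterD; congr iter.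
  by apply/esym/fxE/dvdn_mull.
apply: inj_card_eq => i j; rewrite !in_setE /= => id jd.
wlog ij : i j id jd / (i <= j)%N => [hw|].
  by case: (leqP i j) => [/hw|/ltnW /hw h /esym /h]; [apply|move=> <-].
(* Cancelling the first [i] iterations leaves [j - i < d] divisible by [d], hence zero. *)
rewrite -{1}(subnKC ij) iterD => /iter_inj /esym /fxE dvd.
have := dvdn_leq _ dvd; lia.
Qed.

Lemma sin_recurrence {R : realType} (x t : R) :
  sin (x + t + t) = 2 * cos t * sin (x + t) - sin x.
Proof.
have -> : sin x = sin (x + t - t) by rewrite addrK.
by rewrite sinB (sinD (x + t)); ring.
Qed.

(** * Dynamics of the piecewise linear shift *)

Section Shift.
Variables (R : realType) (m : nat).
Hypothesis m_ge3 : (3 <= m)%N.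
Local Notation theta := (pi / m%:R : R).

Definition tshift (v : R * R) : R * R :=
  (v.2, 2 * cos theta * pospart v.2 - v.1).

(** The solution of the linear recurrence [x (n+2) = 2 cos theta * x (n+1) - x n] with initial
    values [v.1], [v.2]. *)
Definition sinusoid (v : R * R) (n : nat) : R :=
  (sin (theta * n%:R) * v.2 - sin (theta * n%:R - theta) * v.1) / sin theta.

Let m_gt0 : 0 < m%:R :> R.
Proof. by rewrite ltr0n; lia. Qed.

Let theta_m : theta * m%:R = pi.
Proof. by rewrite divfK // gt_eqF. Qed.

Let theta_gt0 : 0 < theta.
Proof. by rewrite divr_gt0 // pi_gt0. Qed.

Lemma sin_theta_gt0 : 0 < sin theta.
Proof.
apply: sin_gt0_pi; rewrite theta_gt0 /= ltr_pdivrMr // ltr_pMr ?pi_gt0 //.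
by rewrite ltr1n; lia.
Qed.

Lemma cos_theta_gt0 : 0 < cos theta.
Proof.
apply: cos_gt0_pihalf; apply/andP; split.
  by apply: lt_trans theta_gt0; rewrite oppr_lt0 divr_gt0 ?pi_gt0.
by rewrite ltr_pM2l ?pi_gt0 // ltf_pV2 ?posrE // ltr_nat.
Qed.

Lemma sin_multiple_ge0 n : (n <= m)%N -> 0 <= sin (theta * n%:R).
Proof.
move=> nm; apply: sin_ge0_pi; rewrite mulr_ge0 ?(ltW theta_gt0) //=.
by rewrite -[leRHS]theta_m ler_pM2l // ler_nat.
Qed.

Lemma sin_multiple_gt0 n : (0 < n < m)%N -> 0 < sin (theta * n%:R).
Proof.
move=> /andP[n0 nm]; apply: sin_gt0_pi; rewrite mulr_gt0 ?ltr0n //=.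
by rewrite -[ltRHS]theta_m ltr_pM2l // ltr_nat.
Qed.

Lemma tshift_inj : injective tshift.
Proof. by case=> a b [c d] [/= -> /addrI /oppr_inj ->]. Qed.

Lemma iter_tshift_inj n : injective (iter n tshift).
Proof. by elim: n => // n IH y z /= /tshift_inj /IH. Qed.

Lemma sinusoid0 v : sinusoid v 0 = v.1.
Proof.
rewrite /sinusoid mulr0 sin0 mul0r !sub0r sinN !mulNr opprK mulrC mulKf //.
by rewrite gt_eqF // sin_theta_gt0.
Qed.

Lemma sinusoid1 v : sinusoid v 1 = v.2.
Proof.
rewrite /sinusoid mulr1 subrr sin0 mul0r subr0 mulrC mulKf //.
by rewrite gt_eqF // sin_theta_gt0.
Qed.

Lemma sinusoidSS v n :
  sinusoid v n.+2 = 2 * cos theta * sinusoid v n.+1 - sinusoid v n.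
Proof.
rewrite /sinusoid.
have -> : theta * n.+2%:R - theta = theta * n%:R - theta + theta + theta.
  by rewrite -!natr1; ring.
have -> : theta * n.+1%:R - theta = theta * n%:R - theta + theta.
  by rewrite -natr1; ring.
have -> : theta * n.+2%:R = theta * n%:R + theta + theta.
  by rewrite -!natr1; ring.
have -> : theta * n.+1%:R = theta * n%:R + theta by rewrite -natr1; ring.
by rewrite !sin_recurrence; ring.
Qed.

Lemma sinusoid_m v : sinusoid v m = - v.1.
Proof.
rewrite /sinusoid theta_m sinpi mul0r sub0r sinB sinpi cospi.
have := sin_theta_gt0; move=> /lt0r_neq0; move: (sin _) => s s0.
by field.
Qed.

Lemma sinusoid_mS v : sinusoid v m.+1 = - v.2.
Proof.
rewrite /sinusoid -natr1 mulrDr mulr1 addrK theta_m sinD sinpi cospi.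
have := sin_theta_gt0; move=> /lt0r_neq0; move: (sin _) => s s0.
by field.
Qed.

(** On nonnegative terms the positive part is the identity, so the shift follows the linear
    recurrence; the term at index 0 never enters a positive part. *)
Lemma iter_tshift v n : (forall j, (0 < j <= n)%N -> 0 <= sinusoid v j) ->
  iter n tshift v = (sinusoid v n, sinusoid v n.+1).
Proof.
elim: n => [|n IH] v_ge0 /=.
  by rewrite sinusoid0 sinusoid1; case: v {v_ge0}.
rewrite IH => [|j /andP[j0 jn]]; last by rewrite v_ge0 // j0 leqW.
by rewrite /tshift /= sinusoidSS /pospart max_l // v_ge0 /=.
Qed.

(** Half-open, so that a nonzero orbit visits it exactly once in each period. *)
Definition sector (v : R * R) : Prop := v.1 <= 0 /\ 0 < v.2.

Lemma sector_sinusoid_gt0 v j : sector v -> (0 < j < m)%N -> 0 < sinusoid v j.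
Proof.
move=> [v1 v2] jm; rewrite divr_gt0 ?sin_theta_gt0 //.
have -> : theta * j%:R - theta = theta * j.-1%:R.
  by rewrite -[in LHS](@prednK j) ?(andP jm).1 // -natr1; ring.
rewrite ltr_wpDr ?mulr_gt0 ?sin_multiple_gt0 // oppr_ge0.
by rewrite mulr_ge0_le0 // sin_multiple_ge0 //; lia.
Qed.

Lemma sector_sinusoid_ge0 v j : sector v -> (0 < j <= m)%N -> 0 <= sinusoid v j.
Proof.
move=> vS /andP[j0]; rewrite leq_eqVlt => /predU1P[->|jm].
  by rewrite sinusoid_m oppr_ge0; case: vS.
by rewrite ltW // sector_sinusoid_gt0 // j0.
Qed.

Lemma tshift_neg v : v.2 <= 0 -> tshift v = (v.2, - v.1).
Proof. by move=> v2; rewrite /tshift /pospart max_r // mulr0 sub0r. Qed.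

Lemma iter_tshift_sector_m v : sector v -> iter m tshift v = (- v.1, - v.2).
Proof.
move=> vS; rewrite iter_tshift ?sinusoid_m ?sinusoid_mS // => j jm.
exact: sector_sinusoid_ge0.
Qed.

(** On [v.2 <= 0] the shift is a quarter turn; the last two steps are such turns and undo the half
    turn made by the first [m]. *)
Lemma iter_tshift_sector v : sector v -> iter (m + 2) tshift v = v.
Proof.
move=> vS; rewrite addn2 !iterS iter_tshift_sector_m //; case: vS => v1 v2.
rewrite !tshift_neg /= ?opprK ?oppr_le0 // ?(ltW v2) //.
by case: v {v1 v2}.
Qed.

(** For [j < m] the first coordinate is positive; for [j = m] and [j = m + 1] the second is
    [- v.2 < 0] and [v.1 <= 0]. *)
Lemma iter_tshift_notin_sector v j :
  sector v -> (0 < j < m + 2)%N -> ~ sector (iter j tshift v).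
Proof.
move=> vS /andP[j0 jm2] []; case: (ltngtP j m) => jm.
- rewrite iter_tshift => [|i ?]; last by apply: sector_sinusoid_ge0 => //; lia.
  by move=> /= + _; rewrite leNgt sector_sinusoid_gt0 // j0.
- have -> : j = m.+1 by lia.
  rewrite iterS iter_tshift_sector_m //; case: vS => v1 v2.
  by rewrite tshift_neg /= ?oppr_le0 ?(ltW v2) // opprK => _; rewrite ltNge v1.
- rewrite jm iter_tshift_sector_m //=; case: vS => _ v2 _.
  by rewrite oppr_gt0 ltNge (ltW v2).
Qed.

(** Successive quarter turns reach the sector in one, two or three steps, depending on where [v]
    lies in the closed lower half-plane. *)
Lemma reach_sector_neg v :
  v <> (0, 0) -> v.2 <= 0 -> exists n, sector (iter n tshift v).
Proof.
move=> v0 v2.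
case: (ltP v.1 0) => v1.
  by exists 1%N; rewrite /= tshift_neg //; split; rewrite /= ?oppr_gt0.
move: v2; rewrite le_eqVlt => /predU1P[v2|v2].
  exists 3%N; rewrite /= !tshift_neg /= ?v2 ?oppr0 ?oppr_le0 // opprK.
  split=> //=; rewrite lt_neqAle v1 andbT; apply/eqP => v1E.
  by apply: v0; rewrite [v]surjective_pairing -v1E v2.
exists 2%N; rewrite /= !tshift_neg /= ?oppr_le0 ?(ltW v2) //.
by split; rewrite /= ?oppr_le0 ?oppr_gt0.
Qed.

(* From a point with positive first coordinate the sinusoid cannot stay positive
   for [m] steps, as it takes the value [- v.1] there. *)
Lemma reach_sector v : v <> (0, 0) -> exists n, sector (iter n tshift v).
Proof.
move=> v0; case: (leP v.2 0) => v2; first exact: reach_sector_neg.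
case: (leP v.1 0) => v1; first by exists 0%N.
have ex_npos : exists n, sinusoid v n.+1 <= 0.
  by exists m.-1; rewrite prednK ?sinusoid_m ?oppr_le0 ?ltW //; lia.
case: (ex_minnP ex_npos) => n n_npos n_min.
have v_pos j : (j <= n)%N -> 0 < sinusoid v j.
  case: j => [|j] jn; first by rewrite sinusoid0.
  by rewrite ltNge; apply/negP => /n_min; lia.
have vn : iter n tshift v = (sinusoid v n, sinusoid v n.+1).
  by apply: iter_tshift => j /andP[_ /v_pos /ltW].
have [|//|k kS] := @reach_sector_neg (iter n tshift v).
- by rewrite vn => -[/eqP]; rewrite gt_eqF // v_pos.
- by rewrite vn.
- by exists (k + n)%N; rewrite iterD.
Qed.

Lemma iter_tshiftE v k :
  v <> (0, 0) -> iter k tshift v = v <-> (m + 2 %| k)%N.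
Proof.
move=> /reach_sector[n nS]; set w := iter n tshift v in nS.
(* Injectivity lets the base point move along the orbit into the sector. *)
have -> : iter k tshift v = v <-> iter k tshift w = w.
  rewrite /w -iterD addnC iterD; split=> [->//|/iter_tshift_inj //].
split; last first.
  move=> /dvdnP[c ->]; elim: c => // c IH.
  by rewrite mulSn iterD IH iter_tshift_sector.
apply: iter_eq_dvdn => [||j jm wj]; [by rewrite addn2|exact: iter_tshift_sector|].
by apply: (iter_tshift_notin_sector w j nS jm); rewrite wj.
Qed.

End Shift.

(** * Conjugating the tropical map to the squared shift *)

Section Conjugation.
Variables (R : realType) (p q : R) (m : nat).
Hypotheses (p_gt0 : 0 < p) (q_gt0 : 0 < q) (m_ge3 : (3 <= m)%N).
Hypothesis pqE : p * q = 4%:R * cos (pi / m%:R) ^+ 2.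

(** The scaling replaces [p] and [q] by the common factor [sqrt (p * q)]; the sign absorbs the
    negations, so that each of [mut1], [mut2] becomes one shift step. *)
Definition rescale (v : R * R) : R * R :=
  (- (Num.sqrt q * v.2), Num.sqrt p * v.1).

Lemma rescale_inj : injective rescale.
Proof.
move=> [a b] [c d] [/oppr_inj /mulfI bd /mulfI ac].
by rewrite bd ?ac // gt_eqF // sqrtr_gt0.
Qed.

Lemma pospartM (c x : R) : 0 <= c -> pospart (c * x) = c * pospart x.
Proof. by move=> c0; rewrite /pospart maxr_pMr // mulr0. Qed.

(** Since [m >= 3], the cosine is positive and the root needs no absolute value. *)
Lemma sqrt_pq : Num.sqrt p * Num.sqrt q = 2 * cos (pi / m%:R).
Proof.
have c0 := cos_theta_gt0 R m m_ge3.
rewrite -sqrtrM ?ltW // pqE -[RHS]ger0_norm ?mulr_ge0 ?ltW // -sqrtr_sqr.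
by congr Num.sqrt; ring.
Qed.

Lemma rescale_tropical v :
  rescale (tropical_map p q v) = tshift R m (tshift R m (rescale v)).
Proof.
case: v => s t; rewrite /rescale /tropical_map /mut1 /mut2 /tshift /= -sqrt_pq.
set x := pospart s.
have pE : p = Num.sqrt p * Num.sqrt p by rewrite -expr2 sqr_sqrtr // ltW.
have qE : q = Num.sqrt q * Num.sqrt q by rewrite -expr2 sqr_sqrtr // ltW.
rewrite (pospartM (Num.sqrt p)) ?sqrtr_ge0 // -/x.
have -> : Num.sqrt p * Num.sqrt q * (Num.sqrt p * x) - - (Num.sqrt q * t)
          = Num.sqrt q * (t + p * x) by rewrite [in RHS]pE; ring.
rewrite (pospartM (Num.sqrt q)) ?sqrtr_ge0 //; set y := pospart _.
by congr (_, _); [ring | rewrite [in LHS]qE; ring].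
Qed.

Lemma rescale_iter v k :
  rescale (iter k (tropical_map p q) v) = iter k.*2 (tshift R m) (rescale v).
Proof. by elim: k => //= k IH; rewrite rescale_tropical IH. Qed.

Lemma tropical_inj : injective (tropical_map p q).
Proof.
move=> v w /(congr1 rescale); rewrite !rescale_tropical.
by move=> /tshift_inj /tshift_inj /rescale_inj.
Qed.

Lemma iter_tropicalE v k :
  v <> (0, 0) -> iter k (tropical_map p q) v = v <-> (m + 2 %| k.*2)%N.
Proof.
move=> v0; rewrite -(iter_tshiftE R m m_ge3 (rescale v)) => [|v0'].
  by rewrite -rescale_iter; split=> [->|/rescale_inj].
by apply/v0/rescale_inj; rewrite v0' /rescale /= !mulr0 oppr0.
Qed.

End Conjugation.

(* The origin is a fixed point of the map, so it is excluded from the claim on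
   orbit sizes. *)
Theorem theorem3p12 (R : realType) (p q : R) (m : nat)
    (p_gt0 : 0 < p) (q_gt0 : 0 < q) (m_ge3 : (3 <= m)%N)
    (pqE : p * q = 4%:R * cos (pi / m%:R) ^+ 2) :
  let N := if odd m then (m + 2)%N else ((m + 2) %/ 2)%N in
  periodic_of_order (tropical_map p q) N /\
  (forall v : R * R, v <> (0, 0) ->
     (forward_orbit (tropical_map p q) v #= `I_N)%card).
Proof.
move=> N.
have N_gt0 : (0 < N)%N by rewrite /N; case: odd; lia.
(* One tropical step is two shift steps: for odd [m] the factor 2 is coprime to [m + 2], for even
   [m] it cancels. *)
have dvdN k : (m + 2 %| k.*2)%N = (N %| k)%N.
  rewrite -muln2 /N; case: ifP => m_odd.
    by rewrite Gauss_dvdl // coprimen2 oddD m_odd.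
  have m2E : (m + 2 = (m + 2) %/ 2 * 2)%N by lia.
  by rewrite {1}m2E dvdn_pmul2r.
have perE v k : v <> (0, 0) -> iter k (tropical_map p q) v = v <-> (N %| k)%N.
  by rewrite -dvdN; apply: iter_tropicalE.
have map0 : tropical_map p q (0, 0) = (0, 0).
  rewrite /tropical_map /mut1 /mut2 /pospart /=.
  by rewrite !(maxxx, oppr0, mulr0, addr0).
split.
  split=> // [v|k k_gt0 fk].
    have [->|/eqP v0] := eqVneq v (0, 0); last exact/perE.
    by elim: N {N_gt0 dvdN perE} => //= n ->.
  (* Any single nonzero point, here [(1, 0)], already has exact period [N]. *)
  apply: dvdn_leq => //; apply/(perE (1, 0)) => // -[/eqP].
  by rewrite oner_eq0.
move=> v v0; apply: card_forward_orbit => // [k|]; first exact: perE.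
exact: (tropical_inj R p q m).
Qed.
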